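(* For every integer $n\ge 0$, as polynomials in $x$, $$B_{n}^{L}(x)=\sum_{k=0}^{n}(-1)^{n-k}S_{1}(n,k)B_{k}(x).$$
   Context: The Stirling numbers of the first kind $S_1(n,k)$ (signed) are defined by $(x)_n=\sum_{k=0}^n S_1(n,k)x^k$, where $(x)_0=1$ and $(x)_n=x(x-1)\cdots(x-n+1)$ for $n\ge 1$. The Bell polynomials $B_n(x)$ are defined by $e^{x(e^t-1)}=\sum_{n=0}^\infty B_n(x)\frac{t^n}{n!}$ (equivalently $B_n(x)=\sum_{k=0}^n S_2(n,k)x^k$, where $S_2(n,k)$ is the number of ways to partition a set of $n$ elements into $k$ nonempty subsets). For integers $n,k\ge 0$, the unsigned Lah number $L(n,k)$ is the number of ways a set of $n$ elements can be partitioned into $k$ nonempty linearly ordered subsets (so $L(0,0)=1$, $L(n,0)=0$ for $n\ge 1$, $L(n,k)=0$ for $k>n$, and $L(n,k)=\binom{n-1}{k-1}\frac{n!}{k!}$ for $n\ge k\ge 1$). The Lah-Bell polynomials are $B_n^L(x)=\sum_{l=0}^n L(n,l)x^l$ for $n\ge 0$. *)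

(* Defs.v *)
From HB Require Import structures.
From mathcomp Require Import all_boot all_order all_algebra.

Set Implicit Arguments.
Unset Strict Implicit.
Unset Printing Implicit Defensive.

Import Order.TTheory GRing.Theory Num.Theory.
Local Open Scope ring_scope.

Definition falling (n : nat) : {poly int} := \prod_(i < n) ('X - (i%:R)%:P).

(* Signed: (x)_n = \sum_(k <= n) S1 n k * x ^ k. *)
Definition S1 (n k : nat) : int := (falling n)`_k.

(* Formal power series in t over a rat-algebra, given by their coefficients. *)
Section FormalPowerSeries.

Variable A : algType rat.
Implicit Types f g : nat -> A.

Definition fps1 : nat -> A := fun n => (n == 0%N)%:R.

Definition fpst : nat -> A := fun n => (n == 1%N)%:R.

Definition fps_mul f g : nat -> A :=
  fun n => \sum_(i < n.+1) f i * g (n - i)%N.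

Definition fps_pow f (j : nat) : nat -> A := iter j (fps_mul f) fps1.

(* \sum_j f ^ j / j!, only meaningful when f 0 = 0: then f ^ j has no
   coefficient in degree n < j, so summing over j <= n loses nothing. *)
Definition fps_exp f : nat -> A :=
  fun n => \sum_(j < n.+1) (j`!%:R : rat)^-1 *: fps_pow f j n.

End FormalPowerSeries.

(* e ^ (x (e ^ t - 1)), where 'X plays the role of x. *)
Definition bell_egf : nat -> {poly rat} :=
  fps_exp (fun n => 'X * (fps_exp (@fpst {poly rat}) n - fps1 {poly rat} n)).

Definition bell (n : nat) : {poly rat} := (n`!%:R : rat) *: bell_egf n.

(* A nonempty linearly ordered subset of 'I_n is encoded as the nonempty
   duplicate-free sequence listing its elements in increasing order; the bound
   n on the length holds for every duplicate-free sequence over 'I_n. *)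
Definition is_ordered_partition (n : nat) (S : {set n.-bseq 'I_n}) : bool :=
  [forall s in S, (bseqval s != [::]) && uniq s]
  && [forall x : 'I_n, #|[set s in S | x \in bseqval s]| == 1%N].

Definition lah (n k : nat) : nat :=
  #|[set S : {set n.-bseq 'I_n} | is_ordered_partition S & #|S| == k]|.

Definition lah_bell (n : nat) : {poly rat} :=
  \sum_(l < n.+1) (lah n l)%:R *: 'X^l.

(* Main.v *)
Require Import Defs.
From mathcomp Require Import all_boot all_order all_algebra.

Set Implicit Arguments.
Unset Strict Implicit.
Unset Printing Implicit Defensive.

Import Order.TTheory GRing.Theory Num.Theory.
Local Open Scope ring_scope.

(** Both sides start at [1] and satisfy the differential recurrence
    [P_(n+1)' = (n+1) (P_n + P_n')], and their constant terms agree. Since a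
    rational polynomial is determined by its derivative and its constant term,
    they coincide.

    Left-hand side. Distinguish one block of an ordered partition of a set [A]
    into [k+1] blocks and remove it: what is left is an ordered partition into
    [k] blocks of the complement of that block. Counting the pairs (partition,
    distinguished block) both ways gives, for [m = #|A|],
    [(k+1) L(m,k+1) = \sum_(0 < j <= m) m^_j L(m-j,k)], as there are [m^_j]
    lists of [j] distinct elements of [A]. Hence [k! L(m,k) = m! c(k,m)] where
    [c(k,m)] is the number of compositions of [m] into [k] positive parts
    ([lah_compositions]). Splitting off the last term of the sum that defines
    [c(k+1,m+1)] gives [c(k+1,m+1) = c(k+1,m) + c(k,m)], which is the
    differential recurrence read on coefficients ([deriv_lah_bellS]).

    Right-hand side. The series [F = exp(G)] with [G = x(e^t - 1)] satisfies
    [dF/dt = x e^t F = x (F + dF/dx)], which on coefficients is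
    [B_(k+1) = x (B_k + B_k')] ([bellS]). The numbers [(-1)^(n-k) S_1(n,k)] are
    the coefficients of the rising factorial [y(y+1)...(y+n-1)], so the
    right-hand side [R_n] is the image of this polynomial under the linear map
    [y^k |-> B_k], and multiplying by [y+n] becomes
    [R_(n+1) = x (R_n + R_n') + n R_n] ([rising_bellS]). A short induction turns
    this into the differential recurrence ([deriv_rising_bellS]). *)

(** * Counting ordered partitions *)

(** Compositions of [m] into [k] positive parts: [i] is what remains of [m] after
    the removal of one part, of size [m - i]. *)
Fixpoint compositions (k m : nat) : nat :=
  if k is k'.+1 then (\sum_(i < m) compositions k' i)%N else (m == 0)%N.

Lemma compositions_small k m : (m < k)%N -> compositions k m = 0%N.
Proof.
elim: k m => [//|k IHk] m lt_mk /=.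
apply: big1 => i _; apply: IHk.
by rewrite (leq_trans (ltn_ord i)).
Qed.

Section OrderedPartitions.

Variables (T : finType) (N : nat).
Implicit Types (A : {set T}) (S : {set N.-bseq T}) (s : N.-bseq T).

(** The parts of the partition come with an ambient set [A] that shrinks when
    a block is removed, while the type of the blocks stays the same; comparing
    the number of blocks through [x] with the truth value of [x \in A] requires
    at once that the blocks are disjoint, cover [A] and stay inside [A]. *)
Definition ordered_partition_of A S : bool :=
  [forall s in S, (bseqval s != [::]) && uniq s]
  && [forall x : T, #|[set s in S | x \in bseqval s]| == (x \in A)].

Definition block_of A s : bool :=
  [&& bseqval s != [::], uniq s & all (mem A) s].

Lemma card_blocks_size A j : (j <= N)%N ->
  #|[set s : N.-bseq T | uniq s && all (mem A) s & size s == j]|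
    = (#|A| ^_ j)%N.
Proof.
move=> le_jN; rewrite -card_uniq_tuples.
pose w (t : j.-tuple T) : N.-bseq T := widen_bseq le_jN (bseq_of_tuple t).
have w_inj : injective w.
  by move=> t u /(congr1 (@bseqval _ _)) /= tu; apply: val_inj.
rewrite -(card_imset _ w_inj); apply: eq_card => s; rewrite !inE.
apply/andP/imsetP => [[/andP[us sA] /eqP sz_s]|[t]].
  have sz : size s == j by apply/eqP.
  by exists (Tuple sz); [rewrite inE sA us | apply: val_inj].
by rewrite inE => /andP[tA ut] ->; rewrite /= ut tA size_tuple eqxx.
Qed.

Lemma block_of_ordered_partition A S s :
  ordered_partition_of A S -> s \in S -> block_of A s.
Proof.
move=> /andP[/forall_inP hS /forallP hA] sS.
have /andP[s0 us] := hS s sS.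
rewrite /block_of s0 us /=; apply/allP => x xs /=.
have := hA x; case: (x \in A) => // /eqP /cards0_eq /setP /(_ s).
by rewrite !inE sS xs.
Qed.

Lemma ordered_partition_of_setU1 A S s :
  block_of A s -> s \notin S ->
  ordered_partition_of A (s |: S)
    = ordered_partition_of (A :\: [set x in bseqval s]) S.
Proof.
move=> /and3P[s0 us /allP sA] sS; rewrite /ordered_partition_of.
congr (_ && _).
  apply/forall_inP/forall_inP => h r; last first.
    by rewrite !inE => /orP[/eqP->|/h//]; rewrite s0 us.
  by move=> rS; apply: h; rewrite !inE rS orbT.
apply: eq_forallb => x; rewrite !inE.
have [xs|xs] := boolP (x \in bseqval s).
  have -> : [set r in s |: S | x \in bseqval r]
            = s |: [set r in S | x \in bseqval r].
    by apply/setP=> r; rewrite !inE andb_orl; case: eqP => [->|]; rewrite ?xs.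
  rewrite cardsU1 !inE (negPf sS) /=.
  by have /= -> := sA x xs.
congr (_ == _); apply: eq_card => r; rewrite !inE andb_orl.
by case: eqP => [->|]; rewrite ?(negPf xs) ?(negPf sS).
Qed.

Lemma block_notin_ordered_partition A S s :
  bseqval s != [::] ->
  ordered_partition_of (A :\: [set x in bseqval s]) S -> s \notin S.
Proof.
move=> s0 opS; apply/negP => sS.
have /and3P[_ _ /allP] := block_of_ordered_partition opS sS.
case: (bseqval s) s0 => // y u _ /(_ y (mem_head _ _)).
by rewrite /= !inE eqxx.
Qed.

(** Removing [s] and adding it back are inverse bijections. *)
Lemma card_ordered_partition_with_block A s k : block_of A s ->
  #|[set S : {set N.-bseq T} |
       ordered_partition_of A S && (#|S| == k.+1) & s \in S]|
  = #|[set S | ordered_partition_of (A :\: [set x in bseqval s]) S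
               & #|S| == k]|.
Proof.
move=> bs; have s0 : bseqval s != [::] by case/and3P: bs.
rewrite -[RHS](card_in_imset (f := fun S => s |: S)); last first.
  move=> S S'; rewrite !inE => /andP[oS _] /andP[oS' _] eSS'.
  rewrite -(setU1K (block_notin_ordered_partition s0 oS)) eSS'.
  by rewrite setU1K ?(block_notin_ordered_partition s0 oS').
apply: eq_card => S; rewrite inE; apply/andP/imsetP.
  move=> [/andP[oS cS] sS]; exists (S :\ s); last by rewrite setD1K.
  rewrite inE -ordered_partition_of_setU1 ?setD1K ?inE ?eqxx // oS /=.
  by move: cS; rewrite (cardsD1 s) sS.
move=> [S' ]; rewrite inE => /andP[oS' cS'] ->.
have sS' := block_notin_ordered_partition s0 oS'.
by rewrite ordered_partition_of_setU1 // oS' cardsU1 sS' (eqP cS') setU11 eqxx.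
Qed.

(** Double counting of the pairs formed by an ordered partition and one of its
    blocks [s]: the sum over [s] is grouped by the size [j.+1] of [s], and
    [m ^_ j.+1 * (m - j.+1)`! = m`!] makes the factorials independent of [j]. *)
Lemma card_ordered_partition A k : (#|A| <= N)%N ->
  (k`! * #|[set S : {set N.-bseq T} | ordered_partition_of A S & #|S| == k]|
   = #|A|`! * compositions k #|A|)%N.
Proof.
elim: k A => [|k IHk] A leAN.
  rewrite mul1n /=; have [->|/set0Pn[x xA]] := eqVneq A set0.
    rewrite cards0 muln1; apply/eqP/cards1P; exists set0; apply/setP=> S.
    rewrite !inE cards_eq0 andbC; case: eqP => //= ->.
    apply/andP; split; first by apply/forall_inP=> s; rewrite inE.
    apply/forallP=> x; rewrite inE cards_eq0.
    by apply/eqP/setP=> s; rewrite !inE.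
  rewrite cards_eq0 (negPf (_ : A != set0)) ?muln0; last first.
    by apply/set0Pn; exists x.
  apply/eqP; rewrite cards_eq0; apply/eqP/setP=> S.
  rewrite !inE cards_eq0 andbC.
  case: eqP => //= ->; apply/negP=> /andP[_ /forallP /(_ x)].
  rewrite xA eq_sym; apply/negP.
  rewrite (_ : [set _ in _ | _] = set0) ?cards0 //.
  by apply/setP=> s; rewrite !inE.
set F := [set S | _ & _].
have double : (k.+1 * #|F|
    = \sum_(s : N.-bseq T | block_of A s)
        #|[set S | ordered_partition_of (A :\: [set x in bseqval s]) S
                   & #|S| == k]|)%N.
  transitivity (\sum_(S in F) \sum_(s | block_of A s && (s \in S)) 1)%N.
    rewrite mulnC -sum_nat_const; apply: eq_bigr => S.
    rewrite inE => /andP[oS /eqP cS]; rewrite -cS -sum1_card.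
    apply: eq_bigl => s; have [sS|] := boolP (s \in S); last by rewrite andbF.
    by rewrite (block_of_ordered_partition oS sS).
  rewrite (exchange_big_dep (block_of A)) /=; last by move=> S s _ /andP[].
  apply: eq_bigr => s bs; rewrite -(card_ordered_partition_with_block _ bs).
  by rewrite -sum1_card; apply: eq_bigl => S; rewrite !inE bs.
rewrite factS mulnAC [(k.+1 * _ * _)%N]mulnC -?mulnA double big_distrr /=.
have step s : block_of A s ->
    (k`! * #|[set S | ordered_partition_of (A :\: [set x in bseqval s]) S
                   & #|S| == k]|
     = (#|A| - size s)`! * compositions k (#|A| - size s))%N.
  move=> /and3P[_ us /allP sA].
  have cD : #|A :\: [set x in bseqval s]| = (#|A| - size s)%N.
    rewrite cardsDS; last by apply/subsetP=> x; rewrite inE => /sA.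
    by rewrite cardsE (card_uniqP us).
  by rewrite IHk cD // (leq_trans (leq_subr _ _)).
rewrite (eq_bigr _ step).
have size_bounds s : block_of A s -> (0 < size s <= #|A|)%N.
  move=> /and3P[s0 us /allP sA]; rewrite lt0n size_eq0 s0 /=.
  by rewrite -(card_uniqP us); apply: subset_leq_card; apply/subsetP=> x /sA.
have inord_size s : (inord (size s).-1 : 'I_N.+1) = (size s).-1 :> nat.
  by rewrite inordK // ltnS (leq_trans (leq_pred _)) // size_bseq.
(* The index is the size minus one, since blocks are nonempty. *)
rewrite (partition_big (fun s : N.-bseq T => inord (size s).-1 : 'I_N.+1)
          (fun j : 'I_N.+1 => (j < #|A|)%N)) /=; last first.
  by move=> s /size_bounds /andP[s0 sA]; rewrite inord_size prednK.
transitivity (\sum_(j < N.+1 | (j < #|A|)%N)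
   #|A|`! * compositions k (#|A| - j.+1))%N.
  apply: eq_bigr => j jA.
  rewrite -(ffact_fact jA) -mulnA -(@card_blocks_size A j.+1); last first.
    exact: leq_trans jA leAN.
  rewrite -sum_nat_const; apply: eq_big => [s|s /andP[bs /eqP <-]]; last first.
    by have /andP[s0 sA] := size_bounds s bs; rewrite inord_size prednK.
  rewrite inE /block_of -(inj_eq val_inj) /= inord_size -size_eq0.
  by case: (size s) => [|m]; rewrite ?andbF.
rewrite -big_distrr /=; congr (_ * _)%N.
rewrite -(big_ord_widen_cond _ xpredT
            (fun j => compositions k (#|A| - j.+1))) //.
  rewrite (reindex_inj rev_ord_inj) /=; apply: eq_bigr => i _.
  by rewrite subnSK ?subKn // ltnW.
exact: leqW.
Qed.

End OrderedPartitions.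

Lemma lah_compositions n k : (k`! * lah n k = n`! * compositions k n)%N.
Proof.
have := @card_ordered_partition 'I_n n setT k.
rewrite cardsT card_ord => /(_ (leqnn n)) <-.
congr (_ * _)%N; apply: eq_card => S; rewrite !inE; congr (_ && _).
rewrite /is_ordered_partition /ordered_partition_of; congr (_ && _).
by apply: eq_forallb => x; rewrite inE.
Qed.

Lemma lah_small n k : (n < k)%N -> lah n k = 0%N.
Proof.
move=> lt_nk; have := lah_compositions n k.
rewrite compositions_small // muln0 => /eqP.
by rewrite muln_eq0 eqn0Ngt fact_gt0 /= => /eqP.
Qed.

(** * The recurrence for the Lah-Bell polynomials *)

Lemma coef_lah_bell n l : (lah_bell n)`_l = (lah n l)%:R.
Proof.
rewrite /lah_bell -(poly_def n.+1 (fun l => (lah n l)%:R)) coef_poly.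
by case: ltnP => // lt_nl; rewrite lah_small.
Qed.

Lemma lah_bell0 : lah_bell 0 = 1.
Proof.
apply/polyP=> -[|l]; rewrite coef_lah_bell coef1; last by rewrite lah_small.
by have := lah_compositions 0 0; rewrite !mul1n => ->.
Qed.

Lemma lah_bellS_coef0 n : (lah_bell n.+1)`_0 = 0.
Proof.
rewrite coef_lah_bell.
by have := lah_compositions n.+1 0; rewrite mul1n muln0 => ->.
Qed.

(** On the coefficient of [x^i], after multiplying by [i!], this is
    [c(i+1,n+1) = c(i+1,n) + c(i,n)] for the numbers [c] of compositions. *)
Lemma deriv_lah_bellS n :
  (lah_bell n.+1)^`() = (lah_bell n + (lah_bell n)^`()) *+ n.+1.
Proof.
apply/polyP=> i; rewrite coefMn coefD !coef_deriv !coef_lah_bell.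
rewrite -!mulrnA -natrD -mulrnA; congr (_%:R).
apply/eqP; rewrite -(eqn_pmul2l (fact_gt0 i)); apply/eqP.
transitivity (i.+1`! * lah n.+1 i.+1)%N.
  by rewrite factS mulnCA [RHS]mulnC [(i.+1 * _)%N]mulnC.
rewrite lah_compositions /= big_ord_recr -/(compositions i.+1 n) factS.
rewrite -mulnA mulnDr addnC -!lah_compositions mulnA [RHS]mulnC factS.
by rewrite [in RHS]mulnDr [(lah n i.+1 * _)%N]mulnC
           [in RHS]mulnA [(i`! * i.+1)%N]mulnC.
Qed.

(** * Differentiating formal power series *)

Section SeriesProduct.

Variable A : comAlgType rat.
Implicit Types (f g : nat -> A) (p : A).

Lemma eq_fps_mul f f' g g' n :
  f =1 f' -> g =1 g' -> fps_mul f g n = fps_mul f' g' n.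
Proof. by move=> ff' gg'; apply: eq_bigr => i _; rewrite ff' gg'. Qed.

Lemma fps_mul1 g n : fps_mul (fps1 A) g n = g n.
Proof.
rewrite /fps_mul big_ord_recl subn0 mul1r big1 ?addr0 // => i _.
by rewrite mul0r.
Qed.

Lemma fps_mulDl p f f' g n :
  fps_mul (fun m => p * f m + f' m) g n = p * fps_mul f g n + fps_mul f' g n.
Proof.
rewrite /fps_mul big_distrr -big_split; apply: eq_bigr => i _ /=.
by rewrite mulrDl mulrA.
Qed.

Lemma fps_mulDr p f g g' k n :
  fps_mul f (fun m => (p * g m + g' m) *+ k) n
  = (p * fps_mul f g n + fps_mul f g' n) *+ k.
Proof.
rewrite /fps_mul big_distrr -big_split -sumrMnl; apply: eq_bigr => i _ /=.
by rewrite mulrnAr mulrDr mulrCA.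
Qed.

(** The Leibniz rule for [d/dt]: the derivative of a series [f] has
    coefficients [f m.+1 *+ m.+1], and the factor [n.+1] of the left-hand side
    is split as [i + (n.+1 - i)] in each term of the product. *)
Lemma fps_mul_dt f g n :
  fps_mul f g n.+1 *+ n.+1
  = fps_mul (fun m => f m.+1 *+ m.+1) g n
    + fps_mul f (fun m => g m.+1 *+ m.+1) n.
Proof.
transitivity (\sum_(i < n.+2) (f i *+ i) * g (n.+1 - i)%N
  + \sum_(i < n.+2) f i * (g (n.+1 - i)%N *+ (n.+1 - i))).
  rewrite -big_split -sumrMnl; apply: eq_bigr => i _ /=.
  by rewrite mulrnAl mulrnAr -mulrnDr subnKC // -ltnS.
congr (_ + _).
  by rewrite big_ord_recl mulr0n mul0r add0r.
rewrite big_ord_recr /= subnn mulr0n mulr0 addr0.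
by apply: eq_bigr => i _; rewrite subSn // -ltnS.
Qed.

Lemma fps_powS f j n : fps_pow f j.+1 n = fps_mul f (fps_pow f j) n.
Proof. by []. Qed.

Lemma fps_pow_small f j n : f 0 = 0 -> (n < j)%N -> fps_pow f j n = 0.
Proof.
move=> f0; elim: j n => [//|j IHj] n lt_nj.
rewrite fps_powS; apply: big1 => -[[|i] lt_in] _ /=.
  by rewrite f0 mul0r.
rewrite IHj ?mulr0 //; rewrite !ltnS in lt_nj lt_in.
by rewrite -ltnS subnSK // ltnS (leq_trans (leq_subr _ _)).
Qed.

Lemma fps_pow_t j n : fps_pow (fpst A) j n = (n == j)%:R.
Proof.
elim: j n => [//|j IHj] [|n].
  by rewrite fps_powS /fps_mul big_ord1 /fpst mul0r.
rewrite fps_powS /fps_mul big_ord_recl big_ord_recl /= /fpst mul0r add0r mul1r.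
rewrite big1 ?addr0 => [|i _]; first by rewrite subSS subn0 IHj.
by rewrite mul0r.
Qed.

Lemma fps_exp_t n : fps_exp (fpst A) n = (n`!%:R : rat)^-1%:A.
Proof.
rewrite /fps_exp big_ord_recr big1 /= => [|i _]; rewrite fps_pow_t.
  by rewrite eqxx add0r.
by rewrite gtn_eqF ?scaler0.
Qed.

End SeriesProduct.

Lemma fps_mul_deriv (f g : nat -> {poly rat}) n :
  (fps_mul f g n)^`()
  = fps_mul (fun m => (f m)^`()) g n + fps_mul f (fun m => (g m)^`()) n.
Proof.
by rewrite raddf_sum -big_split; apply: eq_bigr => i _ /=; exact: derivM.
Qed.

(** The two hypotheses on derivatives say [dG/dt = x + G] and
    [x dG/dx = G], as holds for [G = x (e^t - 1)]. *)
Section ExponentialOfBellSeries.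

Variable G : nat -> {poly rat}.
Hypothesis G_0 : G 0 = 0.
Hypothesis G_dt : forall n, G n.+1 *+ n.+1 = 'X * fps1 _ n + G n.
Hypothesis G_deriv : forall n, 'X * (G n)^`() = G n.

(** For [j > 0] this is [j G^(j-1) dG/dt = j G^(j-1) (x + G)]. *)
Lemma fps_pow_dt j n :
  fps_pow G j n.+1 *+ n.+1
  = ('X * fps_pow G j.-1 n + fps_pow G j n) *+ j.
Proof.
elim: j n => [|j IHj] n; first by rewrite /= /fps1 mul0rn.
rewrite fps_powS fps_mul_dt (eq_fps_mul _ G_dt (frefl _)).
rewrite fps_mulDl fps_mul1 (eq_fps_mul _ (frefl _) IHj) fps_mulDr.
by case: j {IHj} => [|j]; rewrite ?mulr0n ?addr0 // -mulrS.
Qed.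

Lemma fps_pow_deriv j n : 'X * (fps_pow G j n)^`() = fps_pow G j n *+ j.
Proof.
elim: j n => [|j IHj] n; first by rewrite /= /fps1 -polyC_natr derivC mulr0.
rewrite fps_powS fps_mul_deriv mulrDr mulrS.
rewrite /fps_mul !big_distrr -sumrMnl; congr (_ + _); apply: eq_bigr => i _ /=.
  by rewrite mulrA G_deriv.
by rewrite mulrCA IHj mulrnAr.
Qed.

(** Both sides equal [\sum_j (x G^j + G^(j+1)) / j!], coefficientwise. *)
Lemma fps_exp_dt n :
  fps_exp G n.+1 *+ n.+1 = 'X * (fps_exp G n + (fps_exp G n)^`()).
Proof.
transitivity ('X * fps_exp G n
    + \sum_(j < n.+1) (j`!%:R : rat)^-1 *: fps_pow G j.+1 n).
  rewrite [in LHS]/fps_exp big_ord_recl /= {1}/fps1 scaler0 add0r.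
  rewrite -sumrMnl /fps_exp big_distrr -big_split; apply: eq_bigr => j _ /=.
  rewrite scalerMnr (fps_pow_dt j.+1) -scaler_nat scalerA factS natrM.
  rewrite invfM mulrAC mulVf ?mul1r ?pnatr_eq0 //.
  by rewrite scalerDr scalerAr.
rewrite mulrDr; congr (_ + _).
(* The surplus term, of index [j = n], involves [G^(n+1)] in degree [n]. *)
rewrite big_ord_recr fps_pow_small // scaler0 [LHS]addr0.
rewrite /fps_exp raddf_sum big_distrr big_ord_recl /=.
rewrite /fps1 -polyC_natr linearZ /= derivC scaler0 mulr0 add0r.
apply: eq_bigr => j _ /=.
rewrite linearZ /= -scalerAr (fps_pow_deriv j.+1) -scaler_nat scalerA.
by rewrite factS natrM invfM mulrAC mulVf ?mul1r ?pnatr_eq0.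
Qed.

End ExponentialOfBellSeries.

(** * The recurrence for the Bell polynomials *)

Lemma bellS n : bell n.+1 = 'X * (bell n + (bell n)^`()).
Proof.
rewrite /bell derivZ -scalerDr -scalerAr -fps_exp_dt.
- by rewrite -scaler_nat scalerA -natrM mulnC -factS.
- by rewrite fps_exp_t /fps1 invr1 scale1r subrr mulr0.
- move=> m; rewrite !fps_exp_t /fps1 subr0 -mulrnAr -mulrDr addrC subrK.
  congr (_ * _); rewrite scalerMnl -mulr_natr factS natrM invfM.
  by rewrite mulrAC mulVf ?mul1r // pnatr_eq0.
- move=> m; rewrite fps_exp_t /fps1 alg_polyC -polyC_natr -polyCB.
  rewrite derivM derivC mulr0 addr0.
  by rewrite derivX mul1r.
Qed.

Lemma bell0 : bell 0 = 1.
Proof.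
by rewrite /bell /bell_egf /fps_exp big_ord1 /= /fps1 !invr1 !scale1r.
Qed.

(** * The recurrence for the right-hand side *)

(** The image of the rising factorial [y(y+1)...(y+n-1)] under the linear map
    sending [y^k] to the [k]-th Bell polynomial. *)
Definition rising_bell (n : nat) : {poly rat} :=
  \sum_(k < n.+1) (((-1) ^+ (n - k) * S1 n k)%:~R : rat) *: bell k.

Lemma S1_small n k : (n < k)%N -> S1 n k = 0.
Proof.
move=> lt_nk; apply: nth_default.
by rewrite /falling size_prod_XsubC /index_enum -enumT size_enum_ord.
Qed.

Lemma S1S n k :
  S1 n.+1 k = (if k is k'.+1 then S1 n k' else 0) - S1 n k * n%:R.
Proof.
rewrite /S1 /falling big_ord_recr /= mulrBr coefB coefMX coefMC.
by case: k.
Qed.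

(** Since [bell k.+1 + bell k *+ n] is the image of [y^k (y + n)], the first
    step is the expansion of [y(y+1)...(y+n-1)] times [y + n]. *)
Lemma rising_bellS n :
  rising_bell n.+1
  = 'X * (rising_bell n + (rising_bell n)^`()) + rising_bell n *+ n.
Proof.
transitivity (\sum_(k < n.+1) (((-1) ^+ (n - k) * S1 n k)%:~R : rat)
    *: (bell k.+1 + bell k *+ n)).
  rewrite /rising_bell.
  transitivity (
    \sum_(k < n.+2) (((-1) ^+ (n.+1 - k)
        * (if val k is k'.+1 then S1 n k' else 0))%:~R : rat) *: bell k
    + \sum_(k < n.+2) (((-1) ^+ (n - k) * S1 n k)%:~R : rat) *: (bell k *+ n)).
    rewrite -big_split; apply: eq_bigr => k _ /=.
    rewrite S1S mulrBr rmorphB scalerDl; congr (_ + _).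
    have [le_kn|lt_nk] := leqP k n; last first.
      by rewrite S1_small // mul0r !mulr0 oppr0 !scale0r.
    rewrite subSn // exprS mulN1r mulNr rmorphN opprK mulrA.
    by rewrite rmorphM /= rmorph_nat -scalerA scaler_nat.
  rewrite big_ord_recl /= mulr0 scale0r add0r.
  rewrite [X in _ + X]big_ord_recr /= S1_small // mulr0 scale0r addr0.
  by rewrite -big_split; apply: eq_bigr => k _ /=; rewrite subSS scalerDr.
rewrite /rising_bell raddf_sum -big_split big_distrr -sumrMnl -big_split.
apply: eq_bigr => k _ /=.
set c := _%:~R; rewrite (derivZ c (bell k)) bellS [LHS]scalerDr scalerAr.
by rewrite [in LHS]scalerDr (scalerMnr c (bell k)).
Qed.

Lemma rising_bell0 : rising_bell 0 = 1.
Proof.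
rewrite /rising_bell big_ord1 /= /S1 /falling big_ord0 coef1 mulr1 scale1r.
exact: bell0.
Qed.

(** With [Q_n = R_n + R_n'], differentiating [R_(n+1) = x Q_n + n R_n] gives
    [R_(n+1)' = Q_n + x Q_n' + n R_n'], so the claim [R_(n+1)' = (n+1) Q_n] is
    equivalent to [x Q_n' = n R_n]. The latter is proved by induction: if it
    holds at [n], then [Q_(n+1) = R_(n+1) + (n+1) Q_n], whence
    [x Q_(n+1)' = (n+1) (x Q_n + x Q_n') = (n+1) R_(n+1)]. *)
Lemma deriv_rising_bellS n :
  (rising_bell n.+1)^`() = (rising_bell n + (rising_bell n)^`()) *+ n.+1.
Proof.
set Q := fun n => rising_bell n + (rising_bell n)^`().
have step m : 'X * (Q m)^`() = rising_bell m *+ m ->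
    (rising_bell m.+1)^`() = Q m *+ m.+1.
  move=> hm; rewrite rising_bellS -/(Q m) derivD derivM derivX mul1r hm derivMn.
  by rewrite -addrA -mulrnDl -mulrS.
apply: (step n); elim: n => [|n IHn].
  by rewrite /Q rising_bell0 -polyC1 !derivC addr0 derivC mulr0.
rewrite /Q derivD (step n IHn) derivMn -mulrnDl mulrnAr mulrDr IHn.
by rewrite -rising_bellS.
Qed.

Lemma polyP_deriv (R : numDomainType) (p q : {poly R}) :
  p`_0 = q`_0 -> p^`() = q^`() -> p = q.
Proof.
move=> pq0 dpq; apply/polyP=> -[//|i].
have /eqP := congr1 (fun r : {poly R} => r`_i) dpq.
by rewrite !coef_deriv eqr_pMn2r // => /eqP.
Qed.

(** * Conclusion *)

Theorem theorem7 (n : nat) :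
  lah_bell n =
    \sum_(k < n.+1) (((-1) ^+ (n - k) * S1 n k)%:~R : rat) *: bell k.
Proof.
rewrite -/(rising_bell n); elim: n => [|n IHn].
  by rewrite lah_bell0 rising_bell0.
apply: polyP_deriv; last by rewrite deriv_lah_bellS deriv_rising_bellS IHn.
rewrite lah_bellS_coef0 rising_bellS coefD coefXM add0r coefMn -IHn.
by case: n {IHn} => // n; rewrite lah_bellS_coef0 mul0rn.
Qed.
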